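(* Let $\beta>0$ and let $J,J_1,J_2,h$ be nonzero real numbers. Put $\theta=e^{\beta J}$, $\theta_1=e^{\beta J_1}$, $\theta_2=e^{\beta J_2}$, $\theta_3=e^{\beta h}$ and $\tilde\theta=\theta\sqrt{\theta_2}$, and let $A,B,C,E,f,\eta_1,\eta_2$ and the set $H$ be as defined in the context. If $\theta_2>1/\theta^2$, $3B^2-8AC>0$, $(\theta_1,\tilde\theta)\in H$ and $\eta_1(\theta,\theta_1,\theta_2)<\theta_3<\eta_2(\theta,\theta_1,\theta_2)$, then the function $f/\theta_3$ has three fixed points, i.e. the equation $\theta_3u=f(u)$ has three positive solutions. Thus, for the Potts model described in the context, there are three translation-invariant Gibbs measures $\mu_1,\mu_2,\mu_3$, indicating a phase transition (i.e. there is more than one Gibbs measure).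
   Context: Model. Let $V$ be the vertex set of the semi-infinite Cayley tree of order two, i.e. the rooted tree with root $x^0$ in which every vertex $x$ has exactly two direct successors; $S(x)$ denotes the set of direct successors of $x$. Let $W_n$ be the set of vertices at distance $n$ from $x^0$ and $V_n=W_0\cup\dots\cup W_n$. Spins $\sigma(x)$ take values in $\{1,2,3\}$. The Hamiltonian is $$H(\sigma)=-J\sum_{\langle x,y\rangle}\delta_{\sigma(x)\sigma(y)}-J_1\sum_{\rangle x,y\langle}\delta_{\sigma(x)\sigma(y)}-J_2\sum_{\langle x,y,z\rangle}\delta_{\sigma(x)\sigma(y)\sigma(z)}-h\sum_{x\in V}\delta_{1\sigma(x)} .$$ The first sum is over nearest neighbours (edges). The second is over one-level second neighbours, i.e. unordered pairs $\{x,y\}=S(w)$ of the two direct successors of a common vertex $w$. The third is over triples with $\{x,z\}=S(y)$, and $\delta_{\sigma(x)\sigma(y)\sigma(z)}=\frac12(\delta_{\sigma(x)\sigma(y)}+\delta_{\sigma(y)\sigma(z)})$ for such a triple. Translation-invariant Gibbs measures. These are the Gibbs measures described by the positive solutions $(u,v)$ of the system $$\theta_3u=\frac{\theta_1+2\tilde\theta u(1+v)+2v+\tilde\theta^2\theta_1u^2+\theta_1v^2}{\tilde\theta^2\theta_1+2\tilde\theta(u+v)+\theta_1(u^2+v^2)+2uv},\qquad \theta_3v=\frac{\theta_1+2u+2\tilde\theta v(1+u)+\theta_1u^2+\tilde\theta^2\theta_1v^2}{\tilde\theta^2\theta_1+2\tilde\theta(u+v)+\theta_1(u^2+v^2)+2uv},$$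 one measure for each solution. Here $u$ and $v$ are the limits as $n\to\infty$ of $Z_2^{(n)}/Z_1^{(n)}$ and $Z_3^{(n)}/Z_1^{(n)}$, where $Z_i^{(n)}$ is the partition function (sum of $e^{-\beta H}$) over configurations on $V_n$ with $\sigma(x^0)=i$ under a fixed boundary configuration outside $V_n$. Explicitly, the measure associated with $(u,v)$ has, for every $n$, marginal on $V_n$ proportional to $e^{-\beta H_n(\sigma_n)}\prod_{x\in W_n}z_{\sigma_n(x)}$ with $(z_1,z_2,z_3)=(1,u,v)$, where $H_n$ consists of the interaction terms of $H$ lying in $V_n$ and the field terms for $x\in V_{n-1}$. Solutions with $u=v$ are the solutions of $\theta_3u=f(u)$, with $f$ below. Auxiliary quantities. For $u>0$ let $$f(u)=\frac{(\tilde\theta^2\theta_1+2\tilde\theta+\theta_1)u^2+2(\tilde\theta+1)u+\theta_1}{2(\theta_1+1)u^2+4\tilde\theta u+\tilde\theta^2\theta_1}.$$ Let $$A=2(\theta_1+1)(\tilde\theta^2\theta_1+2\tilde\theta+\theta_1),\quad B=8(\tilde\theta+1)(\theta_1+1),\quad E=\tilde\theta^2\theta_1,$$ $$C=-(\tilde\theta^4+\tilde\theta^2-6)\theta_1^2-(2\tilde\theta^3-6)\theta_1+8\tilde\theta^2+8\tilde\theta,$$ and $H=\{(\theta_1,\tilde\theta): C<-2\sqrt{AE}\}$ (this set $H$ is not to be confused with the Hamiltonian). Finally $\eta_i(\theta,\theta_1,\theta_2)=f(u_i^* )/u_i^*$, $i=1,2$, where $u_1^*,u_2^*$ are the positive solutions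 of $uf'(u)=f(u)$, labelled so that $\eta_1<\eta_2$. *)

(* Defs.v *)
From HB Require Import structures.
From mathcomp Require Import all_boot all_order all_algebra.
From mathcomp Require Import all_classical all_reals all_analysis.

Set Implicit Arguments.
Unset Strict Implicit.
Unset Printing Implicit Defensive.

Import Order.TTheory GRing.Theory Num.Theory.
Import numFieldNormedType.Exports.

Local Open Scope classical_set_scope.
Local Open Scope ring_scope.

(* The semi-infinite Cayley tree of order two: a vertex is the word of left/right
   choices leading to it from the root [::], so its distance to the root is its
   length and its direct successors are succ x false and succ x true. *)
Notation site := (seq bool).

Definition succ (x : site) (b : bool) : site := rcons x b.
Definition sphere (n : nat) : set site := [set x | size x = n].
Definition ball_V (n : nat) : set site := [set x | (size x <= n)%N].

(* The spin values 1, 2, 3 are the elements 0, 1, 2 of 'I_3. *)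
Notation spin := 'I_3.
HB.instance Definition _ := isPointed.Build spin (@ord0 2).

Definition spin1 : spin := @ord0 2.

Definition site_events : set (set (site -> spin)) :=
  [set A | exists x s, A = [set sigma | sigma x = s]].

(* Configurations, with the product sigma-algebra. *)
Notation config := (g_sigma_algebraType site_events).

Section Potts.
Variable R : realType.
Implicit Types (sigma omega : config) (mu nu : probability config R).

Definition delta (s t : spin) : R := (s == t)%:R.
Definition delta3 (r s t : spin) : R := (delta r s + delta s t) / 2.

(* The part of the Hamiltonian made of the interaction terms whose set of
   vertices satisfies K and of the field terms at the vertices of F.  An edge is
   indexed by its upper endpoint and a direction; a pair of one-level second
   neighbours and a triple are indexed by their common predecessor. The sums
   range over classical sets and are meant to be used when these are finite. *)
Definition energy (J J1 J2 h : R) (K : set site -> Prop) (F : set site)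
    (sigma : config) : R :=
  - J * (\sum_(e \in [set e : site * bool | K [set e.1; succ e.1 e.2]])
           delta (sigma e.1) (sigma (succ e.1 e.2)))
  - J1 * (\sum_(w \in [set w : site | K [set succ w false; succ w true]])
           delta (sigma (succ w false)) (sigma (succ w true)))
  - J2 * (\sum_(y \in [set y : site | K [set succ y false; y; succ y true]])
           delta3 (sigma (succ y false)) (sigma y) (sigma (succ y true)))
  - h * (\sum_(x \in F) delta spin1 (sigma x)).

Definition energy_touching (J J1 J2 h : R) (L : set site) : config -> R :=
  energy J J1 J2 h (fun D => D `&` L !=set0) L.

(* The field acts only at the vertices of V_{n-1}. *)
Definition energy_ball (J J1 J2 h : R) (n : nat) : config -> R :=
  energy J J1 J2 h (fun D => D `<=` ball_V n) [set x | (size x < n)%N].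

Definition agree_on (D : set site) (sigma : config) : set config :=
  [set omega | forall x, D x -> omega x = sigma x].

(* Conditional probability of A in the finite volume L with boundary condition
   omega; the configurations agreeing with omega off L are finitely many. *)
Definition gibbs_kernel (beta J J1 J2 h : R) (L : set site) (omega : config)
    (A : set config) : R :=
  let w xi := expR (- beta * energy_touching J J1 J2 h L xi) in
  (\sum_(xi \in agree_on (~` L) omega `&` A) w xi)
    / (\sum_(xi \in agree_on (~` L) omega) w xi).

(* The Dobrushin-Lanford-Ruelle equations. *)
Definition gibbs_measure (beta J J1 J2 h : R) mu : Prop :=
  forall (L : set site) (A : set config), finite_set L -> measurable A ->
    mu A = (\int[mu]_omega (gibbs_kernel beta J J1 J2 h L omega A)%:E)%E.

Definition boundary_law (u v : R) (s : spin) : R := nth 0 [:: 1; u; v] s.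

Definition has_marginals (beta J J1 J2 h u v : R) mu : Prop :=
  forall n : nat, exists c : R, forall sigma : config,
    mu (agree_on (ball_V n) sigma) =
    (c * (expR (- beta * energy_ball J J1 J2 h n sigma)
          * \big[*%R/1]_(x \in sphere n) boundary_law u v (sigma x)))%:E.

Definition ti_system (theta1 ttheta theta3 u v : R) : Prop :=
  let den := ttheta ^+ 2 * theta1 + 2 * ttheta * (u + v)
             + theta1 * (u ^+ 2 + v ^+ 2) + 2 * u * v in
  theta3 * u = (theta1 + 2 * ttheta * u * (1 + v) + 2 * v
                + ttheta ^+ 2 * theta1 * u ^+ 2 + theta1 * v ^+ 2) / den
  /\
  theta3 * v = (theta1 + 2 * u + 2 * ttheta * v * (1 + u)
                + theta1 * u ^+ 2 + ttheta ^+ 2 * theta1 * v ^+ 2) / den.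

(* The root of the tree breaks translation symmetry: as usual for semi-infinite
   trees, translation invariance of a Gibbs measure means that it is given by a
   boundary law (1, u, v) which does not depend on the vertex. *)
Definition ti_gibbs_measure (beta J J1 J2 h u v : R) mu : Prop :=
  let ttheta := expR (beta * J) * Num.sqrt (expR (beta * J2)) in
  [/\ 0 < u, 0 < v,
      ti_system (expR (beta * J1)) ttheta (expR (beta * h)) u v,
      gibbs_measure beta J J1 J2 h mu
    & has_marginals beta J J1 J2 h u v mu].

(* Values on non-measurable sets are irrelevant. *)
Definition distinct_measures mu nu : Prop :=
  exists A : set config, measurable A /\ mu A <> nu A.

Definition phase_transition (beta J J1 J2 h : R) : Prop :=
  exists mu nu, [/\ gibbs_measure beta J J1 J2 h mu,
    gibbs_measure beta J J1 J2 h nu & distinct_measures mu nu].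

Definition potts_f (theta1 ttheta u : R) : R :=
  ((ttheta ^+ 2 * theta1 + 2 * ttheta + theta1) * u ^+ 2
     + 2 * (ttheta + 1) * u + theta1)
  / (2 * (theta1 + 1) * u ^+ 2 + 4 * ttheta * u + ttheta ^+ 2 * theta1).

(* For u > 0, u f'(u) = f(u) reads
   A u^4 + B u^3 + C u^2 + 8 ttheta theta1 u + ttheta^2 theta1^2 = 0.
   The constant term is theta1 * E, not E. *)
Definition potts_A (theta1 ttheta : R) : R :=
  2 * (theta1 + 1) * (ttheta ^+ 2 * theta1 + 2 * ttheta + theta1).
Definition potts_B (theta1 ttheta : R) : R := 8 * (ttheta + 1) * (theta1 + 1).
Definition potts_C (theta1 ttheta : R) : R :=
  - (ttheta ^+ 4 + ttheta ^+ 2 - 6) * theta1 ^+ 2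
  - (2 * ttheta ^+ 3 - 6) * theta1 + 8 * ttheta ^+ 2 + 8 * ttheta.
Definition potts_E (theta1 ttheta : R) : R := ttheta ^+ 2 * theta1.

Definition regionH : set (R * R) :=
  [set p | potts_C p.1 p.2 < - 2 * Num.sqrt (potts_A p.1 p.2 * potts_E p.1 p.2)].

(* eta1 < eta2 are the values of f(u)/u at the two positive solutions of
   u f'(u) = f(u); in particular there are exactly two such solutions. *)
Definition is_eta (f : R -> R) (eta1 eta2 : R) : Prop :=
  exists u1 u2 : R,
    [/\ [set u | 0 < u /\ u * derive1 f u = f u] = [set u1; u2],
        eta1 = f u1 / u1, eta2 = f u2 / u2 & eta1 < eta2].

End Potts.

(* Main.v *)
(* Sign analysis: g(u) = f(u)/u tends to +oo at 0 and to 0 at +oo, and the sign of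
   g' is opposite to that of the quartic attached to u f'(u) = f(u). That quartic
   has positive coefficients except possibly the one of u^2, so it changes sign at
   its two positive roots and nowhere else on u > 0. Hence g has a local minimum
   eta1 followed by a local maximum eta2, and a level strictly between them is
   taken three times, which is the most a cubic allows.

   Measures: a solution (u, v) makes (1, u, v) an eigenvector of the branching
   kernel of the model, so it defines a Markov chain along the tree. Its spins are
   generated in breadth-first order from one uniform real number, read through
   nested partitions of [0, 1[ into intervals whose lengths are the cylinder
   probabilities; the image of Lebesgue measure is the required measure. For a
   finite L, the ratio of the probabilities of two large cylinders differing only
   on L is the ratio of their Boltzmann weights; this is the DLR equation on
   cylinders, and both of its sides are measures. Distinct solutions give distinct
   laws to the spin of the root. *)
Require Import Defs.
From mathcomp Require Import all_boot all_order all_algebra.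
From mathcomp Require Import all_classical all_reals all_analysis.
From mathcomp Require Import finmap ring lra zify.

Import Order.TTheory GRing.Theory Num.Theory.
Import numFieldNormedType.Exports.

Set Implicit Arguments.
Unset Strict Implicit.
Unset Printing Implicit Defensive.

Local Open Scope classical_set_scope.
Local Open Scope ring_scope.

(** * Fixed points of a ratio of two quadratics with positive coefficients *)

Section QuadraticRatio.
Variable R : realType.
Implicit Types u x k : R.

(* Comparing the coefficients of x^3 and of 1 shows that the cofactor of
   (x - a) (x - b) in Q has only positive coefficients. *)
Lemma quartic_two_roots_sign (a0 a1 a2 a3 a4 a b : R) :
  0 < a0 -> 0 < a3 -> 0 < a4 -> 0 < a -> 0 < b -> a != b ->
  let Q x := a4 * x ^+ 4 + a3 * x ^+ 3 + a2 * x ^+ 2 + a1 * x + a0 in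
  Q a = 0 -> Q b = 0 ->
  forall x, 0 < x -> exists2 q, 0 < q & Q x = (x - a) * (x - b) * q.
Proof.
move=> a0p a3p a4p ap bp ab Q Qa Qb x xp.
(* Euclidean division of [Q] by [(y - a) * (y - b)]: the quotient is [a4 * y ^+ 2 + p * y + s] and
   the remainder [l * y + m], which vanishes at two distinct points. *)
pose p := a3 + a4 * (a + b).
pose s := a2 + p * (a + b) - a4 * a * b.
pose l := a1 - p * a * b + s * (a + b).
pose m := a0 - s * a * b.
have QE y : Q y = (y - a) * (y - b) * (a4 * y ^+ 2 + p * y + s) + (l * y + m).
  by rewrite /Q /m /l /s /p; ring.
have la : l * a + m = 0 by move: Qa; rewrite QE subrr !mul0r add0r.
have lb : l * b + m = 0 by move: Qb; rewrite QE subrr mulr0 mul0r add0r.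
have l0 : l = 0.
  have /eqP : l * (a - b) = 0 by lra.
  by rewrite mulf_eq0 subr_eq0 (negbTE ab) orbF => /eqP.
have m0 : m = 0 by move: la; rewrite l0 mul0r add0r.
have sp : 0 < s.
  have abs : a0 = s * (a * b) by rewrite mulrA; move: m0; rewrite /m; lra.
  by move: a0p; rewrite abs pmulr_lgt0 // mulr_gt0.
have pp : 0 < p by rewrite addr_gt0 // mulr_gt0 // addr_gt0.
exists (a4 * x ^+ 2 + p * x + s); last by rewrite QE l0 m0 mul0r !addr0.
apply: addr_gt0 => //; apply: addr_gt0; rewrite mulr_gt0 ?exprn_gt0 //.
Qed.

Lemma cubic_roots_unique (c0 c1 c2 c3 x1 x2 x3 x : R) :
  c3 != 0 -> x1 < x2 -> x2 < x3 ->
  let P x := c3 * x ^+ 3 + c2 * x ^+ 2 + c1 * x + c0 in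
  P x1 = 0 -> P x2 = 0 -> P x3 = 0 -> P x = 0 ->
  [\/ x = x1, x = x2 | x = x3].
Proof.
move=> c30 x12 x23 P P1 P2 P3 Px.
pose p := Poly [:: c0; c1; c2; c3].
have pE y : p.[y] = P y by rewrite horner_Poly /= /P; ring.
have pn0 : p != 0.
  by apply: contra_neq c30 => p0; have := coef_Poly [:: c0; c1; c2; c3] 3; rewrite -/p p0 coef0.
have [->|n1] := eqVneq x x1; first by constructor 1.
have [->|n2] := eqVneq x x2; first by constructor 2.
have [->|n3] := eqVneq x x3; first by constructor 3.
(* Otherwise a nonzero polynomial with at most four coefficients would have four distinct roots. *)
have := max_poly_roots (rs := [:: x; x1; x2; x3]) pn0.
rewrite /= !/root !pE Px P1 P2 P3 eqxx !inE !negb_or n1 n2 n3 (lt_eqF x12).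
rewrite (lt_eqF x23) (lt_eqF (lt_trans x12 x23)) => /(_ isT isT).
by rewrite ltnNge (leq_trans (size_Poly _)).
Qed.

Lemma cubic_ivt (c0 c1 c2 c3 x y : R) : x < y ->
  let P x := c3 * x ^+ 3 + c2 * x ^+ 2 + c1 * x + c0 in
  P x * P y < 0 -> exists z, [/\ x < z, z < y & P z = 0].
Proof.
move=> xy P Pxy.
have cP : continuous P.
  suff -> : P = horner (Poly [:: c0; c1; c2; c3]) by exact: continuous_horner.
  by apply/funext => z; rewrite horner_Poly /= /P; ring.
have [||z zxy Pz] := @IVT _ P x y 0 (ltW xy).
- exact: continuous_subspaceT.
- rewrite ge_min le_max; move: Pxy; case: (ltrgt0P (P x)) => Px.
  + by rewrite pmulr_rlt0 // => /ltW ->; rewrite orbT.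
  + by rewrite nmulr_rlt0 // => /ltW ->; rewrite orbT.
  + by rewrite Px mul0r ltxx.
exists z; move: zxy; rewrite in_itv /= => /andP[xz zy].
(* [IVT] locates the zero in the closed interval; the negative product excludes both ends. *)
have nz w : P w != 0 -> w != z by apply: contra_neq => ->.
have Px : P x != 0 by apply: contraTneq Pxy => ->; rewrite mul0r ltxx.
have Py : P y != 0 by apply: contraTneq Pxy => ->; rewrite mulr0 ltxx.
by split=> //; rewrite lt_neqAle ?xz ?zy ?nz // eq_sym nz.
Qed.

Variables N0 N1 N2 D0 D1 D2 : R.
Hypotheses (N0_gt0 : 0 < N0) (N1_gt0 : 0 < N1) (N2_gt0 : 0 < N2).
Hypotheses (D0_gt0 : 0 < D0) (D1_gt0 : 0 < D1) (D2_gt0 : 0 < D2).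

Let num u := N2 * u ^+ 2 + N1 * u + N0.
Let den u := D2 * u ^+ 2 + D1 * u + D0.
Let f u := num u / den u.
(** The expansion of [num den - u (num' den - num den')], whose zeros on u > 0 are the solutions of
    u f'(u) = f(u). *)
Let Q u := N2 * D2 * u ^+ 4 + 2 * N1 * D2 * u ^+ 3
  + (3 * N0 * D2 + N1 * D1 - N2 * D0) * u ^+ 2 + 2 * N0 * D1 * u + N0 * D0.

Let den_gt0 u : 0 < u -> 0 < den u.
Proof. by move=> u0; rewrite !addr_gt0 ?mulr_gt0 ?exprn_gt0. Qed.

Let quadratic_is_derive (a b c x : R) :
  is_derive x 1 (fun u => a * u ^+ 2 + b * u + c) (2 * a * x + b).
Proof.
pose p : {poly R} := a *: 'X^2 + b *: 'X + c%:P.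
have -> : (fun u => a * u ^+ 2 + b * u + c) = horner p.
  by apply/funext => u; rewrite /p hornerD hornerD !hornerZ hornerXn hornerX hornerC.
have /is_derive_eq := is_derive_poly p x; apply.
rewrite /p !derivD !derivZ derivXn derivX derivC !hornerD !hornerZ hornerMn hornerXn !hornerC; ring.
Qed.

(** In this form f'(x) is f(x) / x minus a multiple of [Q x], so that the terms in f cancel in the
    derivative of [g]. *)
Let f_is_derive x : 0 < x ->
  is_derive x 1 f ((num x * den x - Q x) / (x * den x ^+ 2)).
Proof.
move=> x0; have dx := den_gt0 x0.
have dN := quadratic_is_derive N2 N1 N0 x.
have dD := quadratic_is_derive D2 D1 D0 x.
have dV : is_derive x 1 (fun u => (den u)^-1) (- den x ^- 2 *: (2 * D2 * x + D1)).
  by apply: is_deriveV; rewrite gt_eqF.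
have /is_derive_eq := is_deriveM dN dV; apply.
have ? : den x != 0 by rewrite gt_eqF.
have ? : x != 0 by rewrite gt_eqF.
rewrite /GRing.scale /= -/(num x) -/(den x).
have -> : Q x = num x * den x - x * ((2 * N2 * x + N1) * den x - num x * (2 * D2 * x + D1)).
  by rewrite /Q /num /den; ring.
by field; apply/andP.
Qed.

Let g u := f u / u.

Let g_is_derive x : 0 < x -> is_derive x 1 g (- Q x / (x * den x) ^+ 2).
Proof.
move=> x0; have dx := den_gt0 x0.
have dV : is_derive x 1 (fun u : R => u^-1) (- x ^- 2 *: (1 : R)).
  by apply: is_deriveV; rewrite gt_eqF.
have /is_derive_eq := is_deriveM (f_is_derive x0) dV; apply.
have ? : den x != 0 by rewrite gt_eqF.
have ? : x != 0 by rewrite gt_eqF.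
by rewrite /GRing.scale /= /f; field; apply/andP.
Qed.

Lemma quadratic_ratio_three_fixpoints k e1 e2 : is_eta f e1 e2 -> e1 < k < e2 ->
  exists u1 u2 u3 : R, [/\ u1 < u2, u2 < u3 &
    [set u | 0 < u /\ k * u = f u] = [set u1; u2; u3]].
Proof.
move=> [a [b [Eab -> -> gab]]] /andP[ak kb].
have crit x : 0 < x -> x * derive1 f x = f x -> Q x = 0.
  move=> x0; have dx := den_gt0 x0; have := f_is_derive x0 => fx.
  have ? : den x != 0 by rewrite gt_eqF.
  have ? : x != 0 by rewrite gt_eqF.
  rewrite derive1E (@derive_val _ _ _ _ _ _ _ fx) => H.
  have : Q x = num x * den x - den x ^+ 2 * (x * ((num x * den x - Q x) / (x * den x ^+ 2))).
    by field; apply/andP.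
  by rewrite H /f => ->; field.
have [a0 fa] : 0 < a /\ a * derive1 f a = f a.
  by have : [set a; b] a; [left|rewrite -Eab].
have [b0 fb] : 0 < b /\ b * derive1 f b = f b.
  by have : [set a; b] b; [right|rewrite -Eab].
have ab : a != b by apply: contraTneq gab => ->; rewrite ltxx.
have Qsign : forall x, 0 < x -> exists2 q, 0 < q & Q x = (x - a) * (x - b) * q.
  apply: quartic_two_roots_sign => //; rewrite ?mulr_gt0 //; exact: crit.
(* [is_eta] orders the values of [g], not the points. If b < a, then [Q] is negative between them,
   so [g] does not decrease from b to a, contrary to g a < g b. *)
have altb : a < b.
  rewrite ltNge le_eqVlt eq_sym (negbTE ab) /=; apply/negP => ba.
  have gc x : x \in `]b, a[ -> is_derive x 1 g (- Q x / (x * den x) ^+ 2).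
    by rewrite in_itv /= => /andP[bx _]; apply: g_is_derive; exact: lt_trans bx.
  have cg : {within `[b, a], continuous g}.
    apply: derivable_within_continuous => x; rewrite in_itv /= => /andP[bx _].
    exact: (@ex_derive _ _ _ _ _ _ _ (g_is_derive (lt_le_trans b0 bx))).
  have [c] := MVT ba gc cg.
  rewrite in_itv /= => /andP[bc ca]; have c0 := lt_trans b0 bc.
  have [q q0 ->] := Qsign _ c0; rewrite -/(g a) -/(g b) in gab *.
  move=> E.
  have : 0 <= g a - g b; last by rewrite subr_ge0 leNgt gab.
  rewrite E mulr_ge0 ?subr_ge0 ?(ltW ba) // mulr_ge0 ?invr_ge0 ?sqr_ge0 //.
  rewrite -!mulNr mulr_ge0 ?(ltW q0) //.
  by rewrite mulr_ge0 ?oppr_ge0 ?subr_le0 ?subr_ge0 // ltW.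
(* The fixed points are the positive zeros of this cubic, which has the sign of [k - g x] for x > 0.
   Its signs at 0, [a], [b] and a large [M] alternate, starting with a negative value at 0. *)
pose P x := k * D2 * x ^+ 3 + (k * D1 - N2) * x ^+ 2 + (k * D0 - N1) * x + - N0.
have PE x : P x = k * x * den x - num x by rewrite /P /den /num; ring.
have Pg x : 0 < x -> P x = (x * den x) * (k - g x).
  move=> x0; have dx := den_gt0 x0; rewrite PE /g /f.
  have ? : den x != 0 by rewrite gt_eqF.
  have ? : x != 0 by rewrite gt_eqF.
  by field; apply/andP.
have g0 x : 0 < x -> 0 < g x.
  by move=> x0; rewrite !divr_gt0 ?den_gt0 // !addr_gt0 ?mulr_gt0 // exprn_gt0.
have k0 : 0 < k by exact: lt_trans (g0 _ a0) ak.
have Pa : 0 < P a by rewrite Pg // mulr_gt0 ?subr_gt0 // mulr_gt0 ?den_gt0.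
have Pb : P b < 0 by rewrite Pg // pmulr_rlt0 ?subr_lt0 // mulr_gt0 ?den_gt0.
have [z1 [z10 z1a Pz1]] : exists z, [/\ 0 < z, z < a & P z = 0].
  apply: cubic_ivt => //; rewrite -/(P 0) -/(P a) pmulr_llt0 //.
  by rewrite /P !expr0n /= !mulr0 !add0r oppr_lt0.
have [z2 [az2 z2b Pz2]] : exists z, [/\ a < z, z < b & P z = 0].
  by apply: cubic_ivt => //; rewrite -/(P a) -/(P b) pmulr_rlt0.
(* Chosen so that [M] exceeds both [b] and 1, and the leading coefficient times [M] exceeds
   [N2 + N1 + N0]. The five positive quantities collected below add up to [P M]. *)
pose M := b + 1 + N2 / (k * D2) + N1 / (k * D2) + N0 / (k * D2).
have kD : 0 < k * D2 by exact: mulr_gt0.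
have r0 x : 0 < x -> 0 < x / (k * D2) by move=> x0; rewrite divr_gt0.
have bM : b < M.
  by rewrite /M -!addrA ltrDl !addr_gt0 // r0.
have PM : 0 < P M.
  have [n2 n1 n0] := And3 (r0 _ N2_gt0) (r0 _ N1_gt0) (r0 _ N0_gt0).
  have M1 : 1 < M by rewrite /M; lra.
  have MN : N2 + N1 + N0 < k * D2 * M.
    have -> : k * D2 * M = k * D2 * (b + 1) + (N2 + N1 + N0).
      by rewrite /M; field; rewrite ?(gt_eqF k0) ?(gt_eqF D2_gt0).
    by rewrite ltrDr mulr_gt0 // addr_gt0.
  have M0 : 0 < M by exact: lt_trans ltr01 M1.
  have : 0 < (k * D2 * M - (N2 + N1 + N0)) * M ^+ 2 by rewrite mulr_gt0 ?subr_gt0 ?exprn_gt0.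
  have : 0 < k * D1 * M ^+ 2 by rewrite !mulr_gt0 // exprn_gt0.
  have : 0 < k * D0 * M by rewrite !mulr_gt0.
  have : 0 < N1 * (M * (M - 1)) by rewrite !mulr_gt0 // subr_gt0.
  have : 0 < N0 * ((M + 1) * (M - 1)) by rewrite !mulr_gt0 ?subr_gt0 // addr_gt0.
  rewrite /P; lra.
have [z3 [bz3 _ Pz3]] : exists z, [/\ b < z, z < M & P z = 0].
  by apply: cubic_ivt => //; rewrite -/(P b) -/(P M) nmulr_rlt0.
have [z12 z23] : z1 < z2 /\ z2 < z3 by split; [exact: lt_trans az2|exact: lt_trans bz3].
exists z1, z2, z3; split=> //; apply/seteqP; split=> x /=.
  move=> [x0 kx].
  have Px : P x = 0.
    rewrite PE kx /f mulfVK ?subrr // gt_eqF // den_gt0 //.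
  have kD0 : k * D2 != 0 by rewrite gt_eqF.
  by case: (cubic_roots_unique kD0 z12 z23 Pz1 Pz2 Pz3 Px) => ->; tauto.
have fix_ z : 0 < z -> P z = 0 -> 0 < z /\ k * z = f z.
  move=> z0 /eqP; rewrite PE subr_eq0 => /eqP E; split=> //.
  by rewrite /f -E mulfK // gt_eqF // den_gt0.
move=> [[->|->]|->]; apply: fix_ => //.
  exact: lt_trans az2.
exact: lt_trans bz3.
Qed.

End QuadraticRatio.

(** * A random sequence with prescribed conditional laws, read off one uniform number *)

Section RandomSequence.
Variables (R : realType) (T : finType) (t0 : T) (P : seq T -> T -> R).
Hypothesis P_ge0 : forall w s, 0 <= P w s.
Hypothesis P_sum1 : forall w, \sum_s P w s = 1.
Implicit Types (w : seq T) (s : T) (r : R) (x : nat -> T).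

(* Words are stored with their last letter first. *)
Fixpoint history x n : seq T := if n is n'.+1 then x n' :: history x n' else [::].

(** [P w s] is meant as the conditional probability of the letter [s] after the word [w], and
    [mass w] as the probability that the sequence begins with [w]. *)
Fixpoint mass w : R := if w is s :: w' then mass w' * P w' s else 1.

Definition cum w i : R := \sum_(0 <= j < i) P w (nth t0 (enum T) j).

Fixpoint left_end w : R :=
  if w is s :: w' then left_end w' + mass w' * cum w' (index s (enum T)) else 0.

(* The cells of the words of a given length cut [0, 1[ into intervals whose lengths
   are the masses of the words; the cell of a longer word lies in those of its
   prefixes. *)
Definition cell w : set R := `[left_end w, left_end w + mass w[.

(** The default [t0] is taken only when [r] lies in no cell extending [w], that is, outside the cell
    of [w]. *)
Definition next_letter r w : T := odflt t0 [pick s | `[< cell (s :: w) r >]].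

Fixpoint letters r n : seq T :=
  if n is n'.+1 then next_letter r (letters r n') :: letters r n' else [::].

Definition letter r n : T := next_letter r (letters r n).

Lemma cellE w r : cell w r <-> left_end w <= r < left_end w + mass w.
Proof. by rewrite /cell /= in_itv. Qed.

Lemma mass_ge0 w : 0 <= mass w.
Proof. by elim: w => //= s w IH; rewrite mulr_ge0. Qed.

Lemma cum_le w i j : (i <= j)%N -> cum w i <= cum w j.
Proof. by move=> ij; rewrite /cum (big_cat_nat _ ij) //= lerDl sumr_ge0. Qed.

Lemma cum_ge0 w i : 0 <= cum w i.
Proof. exact: sumr_ge0. Qed.

Lemma cum_index w s : cum w (index s (enum T)) + P w s = cum w (index s (enum T)).+1.
Proof. by rewrite /cum big_nat_recr //= nth_index // mem_enum. Qed.

Lemma cum_size w : cum w (size (enum T)) = 1.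
Proof. by rewrite -(P_sum1 w) -big_enum (big_nth t0). Qed.

Lemma left_end_cons w s : left_end (s :: w) + mass (s :: w) =
  left_end w + mass w * cum w (index s (enum T)).+1.
Proof. by rewrite /= -addrA -mulrDr cum_index. Qed.

Lemma cell_cons w s : cell (s :: w) `<=` cell w.
Proof.
move=> r; rewrite !cellE left_end_cons => /andP[lr rl]; apply/andP; split.
  by rewrite (le_trans _ lr) //= lerDl mulr_ge0 ?mass_ge0 ?cum_ge0.
rewrite (lt_le_trans rl) // lerD2l ler_piMr ?mass_ge0 // -(cum_size w).
by rewrite cum_le // index_mem mem_enum.
Qed.

(** The cells extending [w] follow each other in the order of [enum T]: by monotonicity of [cum],
    the right end of an earlier one is at most the left end of a later one. *)
Lemma cell_disj w s s' r : cell (s :: w) r -> cell (s' :: w) r -> s = s'.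
Proof.
wlog ss' : s s' / (index s (enum T) <= index s' (enum T))%N.
  by move=> H; case: (leqP (index s (enum T)) (index s' (enum T))) => [/H//|/ltnW/H Hs c c'];
    rewrite (Hs c' c).
rewrite !cellE left_end_cons => /andP[_ rs] /andP[s'r _].
move: ss'; rewrite leq_eqVlt => /orP[/eqP E|lt].
  by rewrite -(nth_index t0 (mem_enum T s)) E nth_index // mem_enum.
have : r < r; last by rewrite ltxx.
by rewrite (lt_le_trans rs) // (le_trans _ s'r) // lerD2l ler_wpM2l ?mass_ge0 ?cum_le.
Qed.

Lemma cell_cover w r : cell w r -> exists s, cell (s :: w) r.
Proof.
rewrite cellE => /andP[lr rl].
have ex : exists i, r < left_end w + mass w * cum w i.
  by exists (size (enum T)); rewrite cum_size mulr1.
(* The least such bound is not 0, as [cum w 0] vanishes, and the letter sought is the one just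
   before it. *)
case: (ex_minnP ex) => -[|i] ri mini.
  by move: ri; rewrite /cum big_geq // mulr0 addr0 ltNge lr.
have ile : (i.+1 <= size (enum T))%N by apply: mini; rewrite cum_size mulr1.
exists (nth t0 (enum T) i); rewrite cellE left_end_cons /= index_uniq ?enum_uniq //.
by rewrite ri andbT leNgt; apply/negP => /mini; rewrite ltnn.
Qed.

Lemma cell_next w r : cell w r -> cell (next_letter r w :: w) r.
Proof.
move=> /cell_cover[s sr]; rewrite /next_letter.
by case: pickP => [s' /asboolP//|/(_ s)/asboolP].
Qed.

Lemma cell_letters r n : 0 <= r < 1 -> cell (letters r n) r.
Proof.
by move=> r01; elim: n => [|n IH]; [rewrite cellE /= add0r|exact: cell_next].
Qed.

Lemma cellP x n r :
  cell (history x n) r <-> 0 <= r < 1 /\ letters r n = history x n.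
Proof.
split; last by move=> [r01 <-]; exact: cell_letters.
elim: n => [|n IH] /=; first by rewrite cellE /= add0r.
move=> c; have [r01 E] := IH (cell_cons c); split=> //; congr cons => //.
(* Both the generated letter and [x n] give a cell containing [r], and such cells are disjoint. *)
apply: (@cell_disj (history x n) _ _ r) => //.
by rewrite E; apply: cell_next; exact: cell_cons c.
Qed.

Lemma lettersE r n x :
  letters r n = history x n <-> forall k, (k < n)%N -> letter r k = x k.
Proof.
elim: n => [|n IH] /=; first by split.
split=> [[E /IH H] k|H].
  by rewrite ltnS leq_eqVlt => /orP[/eqP->//|/H].
by congr cons; [exact: H|apply/IH => k kn; apply: H; exact: ltnW].
Qed.

Lemma measurable_cell w : measurable (cell w).
Proof. exact: measurable_itv. Qed.

Lemma measurable_next w s : measurable [set r | next_letter r w = s].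
Proof.
(* The letter [t0] also collects, as the default value, the numbers that lie in no cell extending
   [w]. *)
have -> : [set r | next_letter r w = s] =
    cell (s :: w) `|` (if s == t0 then \bigcap_(s' in [set: T]) ~` cell (s' :: w) else set0).
  apply/seteqP; split=> r /=; rewrite /next_letter; case: pickP => /= [s' /asboolP c|H].
  - by move=> <-; left.
  - by move=> <-; rewrite eqxx; right=> s' _ c; have /asboolP := H s'.
  - by move=> [c'|]; [exact: cell_disj c c'|case: eqP => // _ /(_ s' I)].
  - by move=> [c'|]; [have /asboolP := H s|case: eqP].
apply: measurableU; first exact: measurable_cell.
case: ifP => // _; apply: fin_bigcap_measurable; first exact: finite_finset.
by move=> s' _; apply: measurableC; exact: measurable_cell.
Qed.

Lemma measurable_letters n w : measurable [set r | letters r n = w].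
Proof.
elim: n w => [|n IH] [|s w] /=.
- by rewrite (_ : [set _ | _] = setT) //; apply/seteqP; split.
- by rewrite (_ : [set _ | _] = set0) //; apply/seteqP; split.
- by rewrite (_ : [set _ | _] = set0) //; apply/seteqP; split.
rewrite (_ : [set _ | _] = [set r | next_letter r w = s] `&` [set r | letters r n = w]).
  by apply: measurableI; [exact: measurable_next|exact: IH].
by apply/seteqP; split=> r /= [<- <-].
Qed.

Lemma measurable_letter n s : measurable [set r | letter r n = s].
Proof.
(* The earlier letters take only finitely many values; the event is split according to them. *)
rewrite (_ : [set _ | _] = \bigcup_(t in [set: n.-tuple T])
    ([set r | next_letter r t = s] `&` [set r | letters r n = t])).
  apply: fin_bigcup_measurable; first exact: finite_finset.
  move=> t _; apply: measurableI; [exact: measurable_next|exact: measurable_letters].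
apply/seteqP; split=> [r /= <-|r [t _ [/= <- <-]]//].
have sz : size (letters r n) == n by elim: {s} n => //= n.
by exists (Tuple sz).
Qed.

Lemma mass_history x n : mass (history x n) = \prod_(k < n) P (history x k) (x k).
Proof. by elim: n => [|n IH] /=; rewrite ?big_ord0 // big_ord_recr /= IH. Qed.

Lemma lebesgue_letters x n :
  lebesgue_measure (`[0, 1[%classic `&` [set r | forall k, (k < n)%N -> letter r k = x k])
  = (\prod_(k < n) P (history x k) (x k))%:E.
Proof.
rewrite (_ : _ `&` _ = cell (history x n)).
  rewrite lebesgue_measure_itv /= lte_fin -mass_history.
  have := mass_ge0 (history x n); rewrite ltrDl le_eqVlt.
  case: ltP => [m0 _|_ /orP[/eqP <-//|//]].
  by rewrite -EFinB addrC addKr.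
apply/seteqP; split=> r /=.
  by rewrite in_itv /= => -[r01 /lettersE H]; apply/cellP.
by rewrite in_itv /= => /cellP [r01 /lettersE].
Qed.

End RandomSequence.

(** * Breadth-first numbering of the vertices *)

Section BreadthFirst.
Implicit Types (x : site) (i n : nat).

(* The successors of the vertex number i are the vertices 2 i + 1 and 2 i + 2. *)
Definition bfs x : nat := foldl (fun i (b : bool) => i.*2 + b.+1)%N 0%N x.

Lemma bfs_succ x b : bfs (succ x b) = ((bfs x).*2 + b.+1)%N.
Proof. by rewrite /bfs /succ foldl_rcons. Qed.

(** The vertices at depth d occupy the 2^d numbers from 2^d - 1 on, so balls and spheres become
    intervals of numbers. *)
Lemma bfs_bounds x : (2 ^ size x <= (bfs x).+1 < 2 ^ (size x).+1)%N.
Proof.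
elim/last_ind: x => // x b; rewrite -/(succ x b) bfs_succ /succ size_rcons !expnS.
by case: b; lia.
Qed.

Lemma bfs_inj : injective bfs.
Proof.
elim/last_ind => [|x b IH] y; case/lastP: y => [|y c] //.
- by rewrite -/(succ y c) bfs_succ /= => E; exfalso; move: E; rewrite addnS.
- by rewrite -/(succ x b) bfs_succ /= => E; exfalso; move: E; rewrite addnS.
rewrite -/(succ x b) -/(succ y c) !bfs_succ => E.
(* The parity of the number tells the last direction. *)
have [bc xy] : b = c /\ bfs x = bfs y by case: b c E => -[] E; split=> //; lia.
by rewrite bc (IH y xy).
Qed.

Lemma bfs_surj i : exists x, bfs x = i.
Proof.
elim/ltn_ind: i => -[|i] IH; first by exists [::].
(* The vertex number i + 1 is a successor of the vertex number [i./2], in the direction given by the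
   parity of [i]. *)
have [|x xi] := IH i./2; first by lia.
exists (succ x (odd i)); rewrite bfs_succ xi.
by case: (odd i) (odd_double_half i); lia.
Qed.

Definition vertex i : site := xget [::] [set x | bfs x = i].

Lemma vertexK : cancel vertex bfs.
Proof. by move=> i; rewrite /vertex; case: xgetP => // H; have [x /H] := bfs_surj i. Qed.

Lemma bfsK : cancel bfs vertex.
Proof. by move=> x; apply: bfs_inj; rewrite vertexK. Qed.

Lemma succ_vertex i b : succ (vertex i) b = vertex (i.*2 + b.+1).
Proof. by apply: bfs_inj; rewrite bfs_succ !vertexK. Qed.

Lemma bfs_ball x n : (size x < n)%N = (bfs x < (2 ^ n).-1)%N.
Proof.
have /andP[lo hi] := bfs_bounds x; have n0 := expn_gt0 2 n.
apply/idP/idP => [xn|].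
  have := leq_trans hi (leq_pexp2l (isT : 0 < 2)%N xn); lia.
move=> xn; rewrite ltnNge; apply/negP => nx.
have := leq_trans (leq_pexp2l (isT : 0 < 2)%N nx) lo; lia.
Qed.

Section BigOp.
Variables (T : Type) (idx : T) (op : Monoid.com_law idx) (F : site -> T).

Lemma fsbig_vertex (A : set site) m n :
  (forall x, A x <-> (m <= bfs x < n)%N) ->
  \big[op/idx]_(x \in A) F x = \big[op/idx]_(m <= i < n) F (vertex i).
Proof.
move=> AE; rewrite -(big_map vertex xpredT) [RHS]fsbig_seq.
  apply: eq_fsbigl; apply/seteqP; split=> x /=.
    by move/AE => mxn; apply/mapP; exists (bfs x); rewrite ?mem_index_iota ?bfsK.
  by move/mapP => [i]; rewrite mem_index_iota => mi ->; apply/AE; rewrite vertexK.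
by rewrite map_inj_uniq ?iota_uniq //; exact: (can_inj vertexK).
Qed.

Lemma fsbig_inner n : \big[op/idx]_(x \in [set x : site | (size x < n)%N]) F x =
  \big[op/idx]_(0 <= i < (2 ^ n).-1) F (vertex i).
Proof. by apply: fsbig_vertex => x /=; rewrite bfs_ball. Qed.

(** The upper bound is [(2 ^ n.+1).-1], written in the shape [m.*2.+1] that the product of the chain
    steps has after [m] vertices have received their successors. *)
Lemma fsbig_sphere n : \big[op/idx]_(x \in sphere n) F x =
  \big[op/idx]_((2 ^ n).-1 <= i < (2 ^ n).-1.*2.+1) F (vertex i).
Proof.
apply: fsbig_vertex => x; rewrite /sphere /=.
have -> : (2 ^ n).-1.*2.+1 = (2 ^ n.+1).-1.
  by have := expn_gt0 2 n; rewrite expnS; lia.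
rewrite leqNgt -!bfs_ball -leqNgt; split=> [->|]; lia.
Qed.

End BigOp.

End BreadthFirst.

(** * The Markov chain along the tree given by an eigenvector of the branching kernel *)

Lemma mnormalize_unit d (T : measurableType d) (R : realType)
    (mu : {measure set T -> \bar R}) (P : probability T R) (A : set T) :
  mu setT = 1%E -> mnormalize mu P A = mu A.
Proof. by move=> mu1; rewrite /mnormalize mu1 onee_eq0 /= invr1 mule1. Qed.

Section TreeChain.
Variables (R : realType) (K : spin -> spin -> spin -> R) (z : spin -> R) (kappa : R).
Hypothesis K_gt0 : forall s s0 s1, 0 < K s s0 s1.
Hypothesis z_gt0 : forall s, 0 < z s.
Hypothesis kappa_gt0 : 0 < kappa.
Hypothesis K_eigen : forall s, \sum_s0 \sum_s1 K s s0 s1 * z s0 * z s1 = kappa * z s.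
Implicit Types (w : seq spin) (x : nat -> spin).

Let zsum := \sum_s z s.
Let half s s0 := \sum_s1 K s s0 s1 * z s1.

(* Spins are drawn in breadth-first order: the first successor of a vertex given
   that vertex, the second one given the vertex and its sibling. *)
Definition chain_step w (s : spin) : R :=
  let k := size w in
  if k == 0%N then z s / zsum
  else let p := nth spin1 (rev w) k.-1./2 in
    if odd k then half p s * z s / (kappa * z p)
    else K p (nth spin1 (rev w) k.-1) s * z s / half p (nth spin1 (rev w) k.-1).

Let half_gt0 s s0 : 0 < half s s0.
Proof.
rewrite /half (bigD1 spin1) //= ltr_wpDr ?mulr_gt0 // sumr_ge0 // => s1 _.
by rewrite ltW // mulr_gt0.
Qed.

Let zsum_gt0 : 0 < zsum.
Proof.
by rewrite /zsum (bigD1 spin1) //= ltr_wpDr // sumr_ge0 // => s1 _; rewrite ltW.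
Qed.

Lemma chain_step_ge0 w s : 0 <= chain_step w s.
Proof.
rewrite /chain_step; case: ifP => _; first by rewrite ltW // divr_gt0.
by case: ifP => _; rewrite ltW // divr_gt0 // mulr_gt0.
Qed.

Lemma chain_step_sum1 w : \sum_s chain_step w s = 1.
Proof.
rewrite /chain_step; case: (size w == 0%N); first by rewrite -mulr_suml mulfV ?gt_eqF.
case: (odd (size w)); last first.
  by rewrite -mulr_suml -/(half _ _) mulfV // gt_eqF ?half_gt0.
rewrite -mulr_suml; set p := nth _ _ _.
(* The eigenvector equation is what normalizes the law of the first successor. *)
have -> : \sum_s half p s * z s = kappa * z p; last by rewrite mulfV ?gt_eqF ?mulr_gt0.
rewrite -K_eigen; apply: eq_bigr => s0 _; rewrite /half mulr_suml.
by apply: eq_bigr => s1 _; rewrite mulrAC.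
Qed.

Lemma size_history x n : size (history x n) = n.
Proof. by elim: n => //= n ->. Qed.

Lemma nth_history x n i : (i < n)%N -> nth spin1 (rev (history x n)) i = x i.
Proof.
elim: n => // n IH; rewrite ltnS /= rev_cons nth_rcons size_rev size_history.
by rewrite leq_eqVlt => /orP[/eqP ->|lt]; rewrite ?ltnn ?eqxx // lt IH.
Qed.

Let step x k := chain_step (history x k) (x k).

(** The factor [half], the weight of the first successor summed over its sibling, is the
    normalization of the second draw and cancels. *)
Let step_pair x i : step x i.*2.+1 * step x i.*2.+2 =
  K (x i) (x i.*2.+1) (x i.*2.+2) * z (x i.*2.+1) * z (x i.*2.+2) / (kappa * z (x i)).
Proof.
rewrite /step /chain_step !size_history !nth_history; [|lia..].
rewrite /= odd_double /= doubleK uphalf_double.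
have ? : half (x i) (x i.*2.+1) != 0 by rewrite gt_eqF.
have ? : z (x i) != 0 by rewrite gt_eqF.
have ? : kappa != 0 by rewrite gt_eqF.
by field; rewrite -?/(half _ _); apply/and3P.
Qed.

(** After the vertices below [n] have received their successors, the boundary consists of the
    vertices [n] to [n.*2]. Drawing the successors of [n] brings one kernel factor and one
    [kappa^-1], and replaces [z (x n)] in the boundary product by the weights of the two new
    vertices. *)
Lemma prod_chain_step x n : \prod_(k < n.*2.+1) step x k =
  kappa ^- n / zsum * ((\prod_(0 <= i < n) K (x i) (x i.*2.+1) (x i.*2.+2))
                       * \prod_(n <= i < n.*2.+1) z (x i)).
Proof.
elim: n => [|n IH].
  by rewrite big_ord1 big_geq // big_nat1 expr0 invr1 !mul1r mulrC.
rewrite doubleS 2!big_ord_recr /= IH -mulrA step_pair.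
rewrite [\prod_(0 <= i < n.+1) _]big_nat_recr //=.
rewrite [\prod_(n <= i < _) _]big_ltn; last by lia.
rewrite [\prod_(n.+1 <= i < n.*2.+3) _]big_nat_recr /=; last by lia.
rewrite [\prod_(n.+1 <= i < n.*2.+2) _]big_nat_recr /=; last by lia.
have ? : z (x n) != 0 by rewrite gt_eqF.
have ? : kappa != 0 by rewrite gt_eqF.
have ? : zsum != 0 by rewrite gt_eqF.
rewrite exprSr.
by field; rewrite -?/zsum; apply/and3P; split=> //; rewrite expf_neq0.
Qed.

Let sampler (r : measurableTypeR R) : config := fun y => letter spin1 chain_step r (bfs y).

Let sampler_measurable :
  measurable_fun setT sampler.
Proof.
apply: (@measurability _ _ (measurableTypeR R) config _ _ site_events) => //.
move=> _ [_ [y [s ->]] <-]; rewrite setTI.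
have := measurable_letter spin1 chain_step_ge0 (bfs y) s; exact: id.
Qed.

Lemma tree_chain : exists mu : probability config R, forall n, exists c : R,
  forall sigma : config, mu (agree_on (ball_V n) sigma) =
  (c * ((\big[*%R/1]_(y \in [set y | (size y < n)%N])
           K (sigma y) (sigma (succ y false)) (sigma (succ y true)))
        * \big[*%R/1]_(y \in sphere n) z (sigma y)))%:E.
Proof.
have mI : measurable (`[0, 1[%classic : set (measurableTypeR R)) by exact: measurable_itv.
(* [mnormalize] provides the structure of a probability; the total mass is already 1, so the values
   are those of Lebesgue measure. *)
pose uniform : probability (measurableTypeR R) R :=
  mnormalize (mrestr lebesgue_measure mI) (@dirac _ (measurableTypeR R) (0 : R) R).
have uniformE A : uniform A = lebesgue_measure (A `&` `[0, 1[%classic).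
  apply: mnormalize_unit; rewrite /= /mrestr.
  have -> : [set: measurableTypeR R] `&` `[0, 1[%classic = `[0, 1[%classic by exact: setTI.
  by rewrite lebesgue_measure_itv /= lte_fin ltr01 sube0.
pose X : {mfun measurableTypeR R >-> config} := mfun_Sub (mem_set sampler_measurable).
exists (distribution uniform X) => n.
(* One factor [kappa^-1] for each of the [(2 ^ n).-1] vertices of depth less than [n], and [zsum]
   for the root. *)
exists (kappa ^- (2 ^ n).-1 / zsum) => sigma.
pose x i := sigma (vertex i).
transitivity (
    lebesgue_measure (`[0, 1[%classic `&`
      [set r | forall k, (k < (2 ^ n).-1.*2.+1)%N -> letter spin1 chain_step r k = x k])).
  apply: etrans (uniformE _) _; rewrite setIC; congr (lebesgue_measure (_ `&` _)).
  have E y : ball_V n y <-> (bfs y < (2 ^ n).-1.*2.+1)%N.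
    have -> : (2 ^ n).-1.*2.+1 = (2 ^ n.+1).-1.
      by have := expn_gt0 2 n; rewrite expnS; lia.
    by rewrite -bfs_ball.
  apply/seteqP; split=> r /= H.
    move=> k kn; have Hk : sampler r (vertex k) = sigma (vertex k).
      by apply: H; apply/E; rewrite vertexK.
    by rewrite /x -Hk /sampler vertexK.
  by move=> y /E /H; rewrite /x bfsK.
rewrite (lebesgue_letters spin1 chain_step_ge0 chain_step_sum1) prod_chain_step.
rewrite fsbig_inner fsbig_sphere.
under [in RHS]eq_bigr do rewrite !succ_vertex.
by under [in RHS]eq_bigr => i _ do rewrite addn1 addn2.
Qed.

End TreeChain.

(** * Factorization of the Boltzmann weight, and the eigenvector equation *)

Section LocalWeights.
Variables (R : realType) (beta J J1 J2 h : R).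
Implicit Types (sigma : config) (n : nat).

(** The share of the Hamiltonian attributed to a vertex of spin [s] with successors of spins [s0]
    and [s1], with the opposite sign. *)
Definition local_energy (s s0 s1 : spin) : R :=
  J * (delta R s s0 + delta R s s1) + J1 * delta R s0 s1
  + J2 * delta3 R s0 s s1 + h * delta R spin1 s.

Definition local_weight (s s0 s1 : spin) : R := expR (beta * local_energy s s0 s1).

Lemma finite_inner n : finite_set [set x : site | (size x < n)%N].
Proof.
apply: (@sub_finite_set _ _ (vertex @` [set` iota 0 (2 ^ n).-1])).
  by move=> x /=; rewrite bfs_ball => xn; exists (bfs x); rewrite ?bfsK //= mem_iota.
by apply: finite_image; exact: finite_seq.
Qed.

Lemma fsum_edges (A : set site) (F : site * bool -> R) : finite_set A ->
  \sum_(e \in [set e : site * bool | A e.1]) F e =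
  \sum_(x \in A) (F (x, false) + F (x, true)).
Proof.
move=> finA.
rewrite fsbig_split //=.
rewrite -(@fsbig_image _ _ _ _ _ A (fun x : site => (x, false)) F); last by move=> ? ? _ _ [].
rewrite -(@fsbig_image _ _ _ _ _ A (fun x : site => (x, true)) F); last by move=> ? ? _ _ [].
rewrite -fsbigU0; [|exact: finite_image|exact: finite_image|]; last first.
  by move=> _ [[x _ <-] [y _ []]].
apply: eq_fsbigl; apply/seteqP; split=> [[x [] Ax]|_ [[x Ax <-]|[x Ax <-]]] //.
  by right; exists x.
by left; exists x.
Qed.

Lemma succ_sub_ball x n b : ball_V n (succ x b) <-> (size x < n)%N.
Proof. by rewrite /ball_V /= /succ size_rcons. Qed.

(** An edge, pair or triple lies in V_n exactly when its upper vertex or common predecessor has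
    depth less than [n], so all terms can be indexed by the same vertices as the field. *)
Lemma energy_ballE n sigma : energy_ball J J1 J2 h n sigma =
  - \sum_(x \in [set x : site | (size x < n)%N])
      local_energy (sigma x) (sigma (succ x false)) (sigma (succ x true)).
Proof.
rewrite /energy_ball /energy.
set A := [set x : site | (size x < n)%N].
have finA : finite_set A by exact: finite_inner.
have edgeE : [set e : site * bool | [set e.1; succ e.1 e.2] `<=` ball_V n] =
    [set e | A e.1].
  apply/seteqP; split=> [[x b]|[x b]] /= H.
    by apply/(succ_sub_ball x n b); apply: H; right.
  by move=> _ [->|->]; [exact: ltnW|apply/succ_sub_ball].
have pairE : [set w : site | [set succ w false; succ w true] `<=` ball_V n] = A.
  apply/seteqP; split=> x /= H; first by apply/(succ_sub_ball x n false); apply: H; left.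
  by move=> _ [->|->]; apply/succ_sub_ball.
have tripleE :
    [set y : site | [set succ y false; y; succ y true] `<=` ball_V n] = A.
  apply/seteqP; split=> x /= H; first by apply/(succ_sub_ball x n true); apply: H; right.
  by move=> _ [[->|->]|->]; [apply/succ_sub_ball|exact: ltnW|apply/succ_sub_ball].
rewrite edgeE pairE tripleE fsum_edges //= !mulNr -!opprD; congr (- _).
rewrite !mulr_fsumr -3?fsbig_split //=.
Qed.

Lemma weight_ballE n sigma : expR (- beta * energy_ball J J1 J2 h n sigma) =
  \big[*%R/1]_(x \in [set x : site | (size x < n)%N])
     local_weight (sigma x) (sigma (succ x false)) (sigma (succ x true)).
Proof.
rewrite energy_ballE mulrNN mulr_fsumr !fsbig_finite; [|exact: finite_inner..].
by rewrite expR_sum.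
Qed.

Let theta1 := expR (beta * J1).
Let theta3 := expR (beta * h).
Let ttheta := expR (beta * J) * Num.sqrt (expR (beta * J2)).

(** A triple gives half a delta to each of its two edges, so an edge with equal spins weighs
    [expR (beta * J + beta * J2 / 2)], which is [ttheta]. *)
Lemma local_weightE s s0 s1 : local_weight s s0 s1 =
  (if s == s0 then ttheta else 1) * (if s == s1 then ttheta else 1)
  * (if s0 == s1 then theta1 else 1) * (if s == spin1 then theta3 else 1).
Proof.
have tE : ttheta = expR (beta * J + beta * J2 / 2).
  rewrite expRD /ttheta; congr (_ * _).
  have -> : expR (beta * J2) = expR (beta * J2 / 2) ^+ 2.
    by rewrite -expRM_natl; congr expR; field.
  by rewrite sqrtr_sqr ger0_norm // expR_ge0.
have ifE (b : bool) (x : R) : (if b then expR x else 1) = expR (x * b%:R).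
  by case: b; rewrite ?mulr1 // mulr0 expR0.
rewrite tE /theta1 /theta3 !ifE -!expRD /local_weight /local_energy /delta3 /delta.
rewrite (eq_sym s0 s) (eq_sym spin1 s).
by congr expR; field.
Qed.

Lemma boundary_law_gt0 (u v : R) s : 0 < u -> 0 < v -> 0 < boundary_law u v s.
Proof. by move=> u0 v0; case: s => -[|[|[|]]] //=. Qed.

Lemma local_weight_eigen u v : 0 < u -> 0 < v -> ti_system theta1 ttheta theta3 u v ->
  exists2 kappa : R, 0 < kappa & forall s,
    \sum_s0 \sum_s1 local_weight s s0 s1 * boundary_law u v s0 * boundary_law u v s1
    = kappa * boundary_law u v s.
Proof.
move=> u0 v0 []; set den := (X in _ / X).
have t1 : 0 < theta1 by exact: expR_gt0.
have t3 : 0 < theta3 by exact: expR_gt0.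
have t0 : 0 < ttheta by rewrite mulr_gt0 ?sqrtr_gt0 ?expR_gt0.
have den0 : 0 < den.
  have d1 : 0 < ttheta ^+ 2 * theta1 by rewrite mulr_gt0 ?exprn_gt0.
  have d2 : 0 < ttheta * (u + v) by rewrite mulr_gt0 ?addr_gt0.
  have d3 : 0 < theta1 * (u ^+ 2 + v ^+ 2) by rewrite mulr_gt0 ?addr_gt0 ?exprn_gt0.
  have d4 : 0 < u * v by rewrite mulr_gt0.
  by rewrite /den; lra.
move=> /(congr1 ( *%R^~ den)); rewrite mulfVK ?gt_eqF // => eu.
move=> /(congr1 ( *%R^~ den)); rewrite mulfVK ?gt_eqF // => ev.
(* The eigenvalue is read off the equation for spin 1, where the boundary law is 1; the other two
   equations are the system with its denominators cleared. *)
exists (theta3 * den); first by rewrite mulr_gt0.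
move=> s; rewrite !big_ord_recl !big_ord0 !local_weightE /=.
case: s => -[|[|[|//]]] /= ?; rewrite /boundary_law /=.
- by rewrite /den; ring.
- by rewrite [in RHS]mulrAC eu; ring.
- by rewrite [in RHS]mulrAC ev; ring.
Qed.

Lemma ti_marginals u v : 0 < u -> 0 < v -> ti_system theta1 ttheta theta3 u v ->
  exists mu : probability config R, has_marginals beta J J1 J2 h u v mu.
Proof.
move=> u0 v0 /(local_weight_eigen u0 v0)[kappa k0 eig].
have [|mu mum] := tree_chain _ (fun s => boundary_law_gt0 s u0 v0) k0 eig.
  by move=> *; exact: expR_gt0.
exists mu => n; have [c cE] := mum n; exists c => sigma.
by rewrite cE weight_ballE.
Qed.

End LocalWeights.

(** * Configurations changed on a finite set, and the cylinders over balls *)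

Section Patterns.
Implicit Types (D : {fset site}) (sigma omega xi : config).

Definition glue D (tau : {ffun D -> spin}) omega : config :=
  fun x => if (insub x : option D) is Some y then tau y else omega x.

Definition pattern D sigma : {ffun D -> spin} := [ffun y => sigma (val y)].

Lemma glue_notin D (tau : {ffun D -> spin}) omega x :
  x \notin D -> glue tau omega x = omega x.
Proof. by move=> xD; rewrite /glue insubF //; exact/negbTE. Qed.

Lemma glue_val D (tau : {ffun D -> spin}) omega (y : D) :
  glue tau omega (val y) = tau y.
Proof. by rewrite /glue valK. Qed.

Lemma glue_pattern D xi omega x : x \in D -> glue (pattern D xi) omega x = xi x.
Proof. by move=> xD; rewrite -[x]/(val [` xD]%fset) glue_val ffunE. Qed.

Lemma pattern_glue D (tau : {ffun D -> spin}) omega : pattern D (glue tau omega) = tau.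
Proof. by apply/ffunP => y; rewrite ffunE glue_val. Qed.

Lemma glue_pattern_off D xi omega : (forall x, x \notin D -> omega x = xi x) ->
  glue (pattern D xi) omega = xi.
Proof.
move=> H; apply/funext => x; have [xD|xD] := boolP (x \in D).
  exact: glue_pattern.
by rewrite glue_notin // H.
Qed.

Lemma glue_glue D (tau tau' : {ffun D -> spin}) omega :
  glue tau (glue tau' omega) = glue tau omega.
Proof.
apply/funext => x; have [xD|xD] := boolP (x \in D); last by rewrite !glue_notin.
by rewrite -[x]/(val [` xD]%fset) !glue_val.
Qed.

Lemma glue_inj D omega : injective (fun tau : {ffun D -> spin} => glue tau omega).
Proof. by move=> tau tau' E; rewrite -(pattern_glue tau omega) E pattern_glue. Qed.

Lemma agree_off_glue D omega :
  agree_on (~` [set` D]) omega =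
  [set glue tau omega | tau in [set: {ffun D -> spin}]].
Proof.
apply/seteqP; split=> [xi H|_ [tau _ <-] x /= xD].
  exists (pattern D xi) => //; apply: glue_pattern_off => x xD.
  by rewrite (H x) //=; exact/negP.
by rewrite glue_notin //; exact/negP.
Qed.

Lemma fsbig_setT_fin (V : Type) (idx : V) (op : Monoid.com_law idx) (T : finType)
    (F : T -> V) : \big[op/idx]_(i \in [set: T]) F i = \big[op/idx]_i F i.
Proof.
rewrite (fsbigE (enum T)) ?enum_uniq //; last by move=> i _; rewrite mem_enum.
by rewrite big_enum_cond /=; apply: eq_bigl => i; rewrite in_setT.
Qed.

Lemma fsbig_agree_off (R : realType) D omega (F : config -> R) :
  \sum_(xi \in agree_on (~` [set` D]) omega) F xi =
  \sum_(tau : {ffun D -> spin}) F (glue tau omega).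
Proof.
rewrite agree_off_glue fsbig_image; last by move=> ? ? _ _ /glue_inj.
exact: fsbig_setT_fin.
Qed.

Lemma measurable_site (x : site) (s : spin) : measurable [set sigma : config | sigma x = s].
Proof. by apply: sub_sigma_algebra; exists x, s. Qed.

Lemma measurable_agree_on (A : set site) sigma :
  finite_set A -> measurable (agree_on A sigma).
Proof.
move=> finA.
rewrite (_ : agree_on A sigma = \bigcap_(x in A) [set omega : config | omega x = sigma x]) //.
apply: fin_bigcap_measurable => // x _; exact: measurable_site.
Qed.

Lemma measurable_glue D (tau : {ffun D -> spin}) :
  measurable_fun [set: config] (glue tau : config -> config).
Proof.
apply: (@measurability _ _ config config _ _ site_events) => //.
move=> _ [_ [x [s ->]] <-]; rewrite setTI.
have [xD|xD] := boolP (x \in D).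
  have [E|E] := eqVneq (tau [` xD]%fset) s.
    rewrite (_ : _ @^-1` _ = setT) //; apply/seteqP; split=> // omega _ /=.
    by rewrite -[x]/(val [` xD]%fset) glue_val.
  rewrite (_ : _ @^-1` _ = set0) //; apply/seteqP; split=> // omega /=.
  by rewrite -[x]/(val [` xD]%fset) glue_val; exact/eqP.
rewrite (_ : _ @^-1` _ = [set omega : config | omega x = s]); first exact: measurable_site.
by apply/seteqP; split=> omega /=; rewrite glue_notin.
Qed.

Lemma finite_ball n : finite_set (ball_V n).
Proof. exact: finite_inner n.+1. Qed.

Lemma agree_on_pattern D sigma omega :
  agree_on [set` D] sigma omega <-> pattern D omega = pattern D sigma.
Proof.
split=> [H|H x /= xD]; first by apply/ffunP => y; rewrite !ffunE; apply: H => /=; exact: valP.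
by move/ffunP : H => /(_ [` xD]%fset); rewrite !ffunE.
Qed.

(** An event about one spin is a finite union of cylinders over any ball containing the vertex.
    Radii below [n] are left out because the DLR equation will first be checked on balls large
    enough to surround the finite volume. *)
Lemma cylinders_generate n :
  @measurable _ config = <<s set0 |` [set C | exists N sigma, (n <= N)%N /\
                                      C = agree_on (ball_V N) sigma] >>.
Proof.
set G := (X in <<s X >>).
apply/seteqP; split; last first.
  apply: smallest_sub; first exact: sigma_algebra_measurable.
  move=> _ [->|[N [sigma [_ ->]]]]; first exact: measurable0.
  by apply: measurable_agree_on; exact: finite_ball.
apply: smallest_sub; first exact: smallest_sigma_algebra.
move=> _ [x [s ->]].
pose N := maxn n (size x); pose D := fset_set (ball_V N).
have DE : [set` D] = ball_V N by apply: fset_setK; exact: finite_ball.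
have xD : x \in D.
  rewrite /D in_fset_set; first by apply/mem_set; rewrite /ball_V /= leq_maxr.
  exact: finite_ball.
have -> : [set sigma : config | sigma x = s] =
    \bigcup_(eta in [set eta : {ffun D -> spin} | eta [` xD]%fset = s])
      agree_on (ball_V N) (glue eta (fun=> spin1)).
  rewrite -DE; apply/seteqP; split=> omega /=.
    move=> os; exists (pattern D omega); first by rewrite /= ffunE.
    by apply/agree_on_pattern; rewrite pattern_glue.
  by move=> [eta /= <- /agree_on_pattern]; rewrite pattern_glue => <-; rewrite ffunE.
apply: (@fin_bigcup_measurable _ (g_sigma_algebraType G)); first exact: finite_finset.
move=> eta _; apply: sub_sigma_algebra; right.
by exists N, (glue eta (fun=> spin1)); rewrite leq_maxl.
Qed.

(** Balls are nested, so two such cylinders are either disjoint or one contains the other. *)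
Lemma cylinders_setI n : setI_closed (set0 |` [set C : set config |
  exists N sigma, (n <= N)%N /\ C = agree_on (ball_V N) sigma]).
Proof.
have main N M sigma sigma' : (n <= M)%N -> (N <= M)%N ->
    (set0 |` [set C | exists N sigma, (n <= N)%N /\ C = agree_on (ball_V N) sigma])
    (agree_on (ball_V N) sigma `&` agree_on (ball_V M) sigma').
  move=> nM NM; have [H|H] := pselect (agree_on (ball_V N) sigma sigma').
    right; exists M, sigma'; split=> //; apply/seteqP; split=> [omega []//|omega Ho].
    split=> // x xN; rewrite (Ho x); first exact: H.
    exact: leq_trans xN NM.
  left; apply/seteqP; split=> // omega [H1 H2]; apply: H => x xN.
  by rewrite -(H2 x) ?(H1 x) //; exact: leq_trans xN NM.
move=> A B [->|[N [sigma [nN ->]]]] => [_|[->|[M [sigma' [nM ->]]]]].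
- by rewrite set0I; left.
- by rewrite setI0; left.
have [NM|/ltnW MN] := leqP N M; first exact: main.
by rewrite setIC; exact: main.
Qed.

End Patterns.

(** * Finite mixtures of restricted image measures *)

Section FiniteMixture.
Variables (R : realType) (d : measure_display) (T : measurableType d).
Variable mu : {measure set T -> \bar R}.

(** This is the form that the integral of the Gibbs kernel takes; it shows that this integral is a
    measure in the event. *)
Lemma finite_mixture (I : Type) (s : seq I) (k : I -> R) (S : I -> set T) (f : I -> T -> T) :
  (forall i, 0 <= k i) -> (forall i, measurable (S i)) ->
  (forall i, measurable_fun setT (f i)) ->
  exists m : {measure set T -> \bar R}, forall A, measurable A ->
    m A = (\sum_(i <- s) (k i)%:E * mu (S i `&` f i @^-1` A))%E.
Proof.
move=> k0 mS mf; elim: s => [|i s [m mE]].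
  by exists mzero => A _; rewrite big_nil.
have [m' m'E] : exists m' : {measure set T -> \bar R}, forall A,
    m' A = mu (f i @^-1` A `&` S i).
  unshelve eexists (pushforward (mrestr mu (mS i)) (f i)); first exact: mf.
  by [].
exists (measure_add (mscale (NngNum (k0 i)) m') m) => A mA.
apply: etrans (measure_addE _ _ _) _.
by rewrite big_cons mE // /= /mscale /= m'E setIC.
Qed.

End FiniteMixture.

(** * The DLR equations from the marginals *)

Section Specification.
Variables (R : realType) (beta J J1 J2 h : R).
Implicit Types (sigma omega xi : config) (N : nat) (A : set config).

Lemma energy_local (K : set site -> Prop) (F : set site) sigma omega :
  (forall D, K D -> forall x, D x -> sigma x = omega x) ->
  (forall x, F x -> sigma x = omega x) ->
  energy J J1 J2 h K F sigma = energy J J1 J2 h K F omega.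
Proof.
move=> KE FE; rewrite /energy; congr (_ * _ - _ * _ - _ * _ - _ * _).
- apply: eq_fsbigr => -[x b] /set_mem /= /KE E.
  by rewrite (E x) ?(E (succ x b)); [|right|left].
- apply: eq_fsbigr => x /set_mem /= /KE E.
  by rewrite (E (succ x false)) ?(E (succ x true)); [|right|left].
- apply: eq_fsbigr => x /set_mem /= /KE E.
  by rewrite (E (succ x false)) ?(E (succ x true)) ?(E x); [|left; right|right|left; left].
- by apply: eq_fsbigr => x /set_mem /FE ->.
Qed.

Lemma fsum_split (I : choiceType) (A A1 A2 : set I) (F : I -> R) :
  finite_set A -> (forall i, A i <-> A1 i \/ A2 i) -> (forall i, A1 i -> ~ A2 i) ->
  \sum_(i \in A) F i = \sum_(i \in A1) F i + \sum_(i \in A2) F i.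
Proof.
move=> finA AE dis.
have -> : A = A1 `|` A2 by apply/seteqP; split=> i /AE.
apply: fsbigU0; last by move=> i [/dis].
- by apply: sub_finite_set finA => i ?; apply/AE; left.
- by apply: sub_finite_set finA => i ?; apply/AE; right.
Qed.

(** The strict bound keeps the successors of [L] inside V_N, so every term touching [L] belongs to
    the energy of the ball. The remaining terms do not see the spins on [L]. *)
Lemma energy_ball_split N (L : set site) sigma : (forall x, L x -> (size x < N)%N) ->
  energy_ball J J1 J2 h N sigma = energy_touching J J1 J2 h L sigma +
    energy J J1 J2 h (fun D => D `<=` ball_V N /\ ~ (D `&` L !=set0))
      ([set x | (size x < N)%N] `\` L) sigma.
Proof.
move=> LN; rewrite /energy_ball /energy_touching /energy.
(* Here [p i] is the upper vertex or common predecessor of the term [i]; its bounded depth makes the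
   sums finite. *)
have split_ (I : choiceType) (D : I -> set site) (F : I -> R) (p : I -> site) :
    (forall i, D i `<=` ball_V N -> (size (p i) < N)%N) ->
    finite_set [set i | (size (p i) < N)%N] ->
    (forall i, D i `&` L !=set0 -> D i `<=` ball_V N) ->
    \sum_(i \in [set i | D i `<=` ball_V N]) F i =
    \sum_(i \in [set i | D i `&` L !=set0]) F i +
    \sum_(i \in [set i | D i `<=` ball_V N /\ ~ (D i `&` L !=set0)]) F i.
  move=> Dp finp tb; apply: fsum_split.
  - by apply: sub_finite_set finp => i /Dp.
  - move=> i; split=> [Di|[/tb//|[]//]].
    by have [t|t] := pselect (D i `&` L !=set0); [left|right].
  - by move=> i t [].
have Ls x b : L (succ x b) -> (size x < N)%N.
  by move/LN; rewrite /succ size_rcons; exact: ltnW.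
have in_ball x b : (size x < N)%N -> ball_V N (succ x b) by move/succ_sub_ball.
have in_ball0 x : (size x < N)%N -> ball_V N x by exact: ltnW.
rewrite (@split_ _ (fun e : site * bool => [set e.1; succ e.1 e.2]) _ fst); first last.
- move=> [x b] [y [/= [->|->]]].
    by move/LN => xN _ [->|->]; auto.
  by move/Ls => xN _ [->|->]; auto.
- apply: (@sub_finite_set _ _ ([set x : site | (size x < N)%N] `*` [set: bool])).
    by move=> [x b] /= xN.
  by apply: finite_setX; [exact: finite_inner|exact: finite_finset].
- by move=> [x b] /= H; apply/(succ_sub_ball x N b); apply: H; right.
rewrite (@split_ _ (fun w => [set succ w false; succ w true]) _ id); first last.
- by move=> w [y [/= [->|->]]] /Ls wN _ [->|->]; auto.
- exact: finite_inner.
- by move=> w /= H; apply/(succ_sub_ball w N true); apply: H; right.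
rewrite (@split_ _ (fun y => [set succ y false; y; succ y true]) _ id); first last.
- move=> w [y [/= [[->|->]|->]]].
  + by move/Ls => wN _ [[->|->]|->]; auto.
  + by move/LN => wN _ [[->|->]|->]; auto.
  + by move/Ls => wN _ [[->|->]|->]; auto.
- exact: finite_inner.
- by move=> w /= H; apply/(succ_sub_ball w N true); apply: H; right.
rewrite (@fsum_split _ [set x | (size x < N)%N] L ([set x | (size x < N)%N] `\` L)); first last.
- by move=> x Lx [].
- by move=> x; split=> [xN|[/LN//|[]//]]; have [|] := pselect (L x); [left|right].
- exact: finite_inner.
by ring.
Qed.

Variables (L : {fset site}) (n : nat).
Hypothesis L_ball : forall x, x \in L -> (size x < n)%N.

Let w xi := expR (- beta * energy_touching J J1 J2 h [set` L] xi).
Let Z omega := \sum_(tau : {ffun L -> spin}) w (glue tau omega).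

Let w_gt0 xi : 0 < w xi.
Proof. exact: expR_gt0. Qed.

Let Z_gt0 omega : 0 < Z omega.
Proof.
rewrite /Z (bigD1 (pattern L omega)) //= ltr_wpDr // sumr_ge0 // => tau _.
exact: ltW.
Qed.

Let L_setP x : [set` L] x -> (size x < n)%N.
Proof. exact: L_ball. Qed.

Let w_local sigma omega : agree_on (ball_V n) sigma omega -> w omega = w sigma.
Proof.
move=> E; rewrite /w; congr (expR (_ * _)).
have Ei x : (size x < n)%N -> omega x = sigma x by move=> xn; apply: E; exact: ltnW.
(* Adding the terms away from [L], which depend only on the spins in V_n, turns both sides into
   energies of the ball, which do so as well. *)
apply: (@addIr _ (energy J J1 J2 h (fun D => D `<=` ball_V n /\ ~ (D `&` [set` L] !=set0))
  ([set x | (size x < n)%N] `\` [set` L]) omega)).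
rewrite -(energy_ball_split _ L_setP).
rewrite (_ : energy J J1 J2 h _ _ omega = energy J J1 J2 h
  (fun D => D `<=` ball_V n /\ ~ (D `&` [set` L] !=set0))
  ([set x | (size x < n)%N] `\` [set` L]) sigma).
  rewrite -(energy_ball_split _ L_setP).
  by apply: energy_local => [D Dn x /Dn|x] /= ?; [exact: E|exact: Ei].
by apply: energy_local => [D [Dn _] x /Dn|x [/= ? _]]; [exact: E|exact: Ei].
Qed.

Let glue_agree (A : set site) (tau : {ffun L -> spin}) sigma omega :
  agree_on A sigma omega -> agree_on A (glue tau sigma) (glue tau omega).
Proof.
move=> E x Ax; have [xL|xL] := boolP (x \in L); last by rewrite !glue_notin // E.
by rewrite -[x]/(val [` xL]%fset) !glue_val.
Qed.

Let Z_local sigma omega : agree_on (ball_V n) sigma omega -> Z omega = Z sigma.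
Proof. by move=> E; apply: eq_bigr => tau _; apply: w_local; exact: glue_agree. Qed.

Let gibbs_kernelE omega A : gibbs_kernel beta J J1 J2 h [set` L] omega A =
  (\sum_(tau : {ffun L -> spin}) w (glue tau omega) * \1_A (glue tau omega)) / Z omega.
Proof.
rewrite /gibbs_kernel fsbig_mkcondr !fsbig_agree_off -/(Z omega); congr (_ / _).
apply: eq_bigr => tau _; rewrite indicE /w.
by case: (_ \in _); rewrite ?mulr1 ?mulr0.
Qed.

Variables (u v : R) (mu : probability config R).
Hypothesis mu_marginals : has_marginals beta J J1 J2 h u v mu.

(** The factor [g] gathers the terms away from [L] and the boundary product over the sphere, which
    is disjoint from [L]; neither changes with [tau]. *)
Let cylinder_weight N xi : (n <= N)%N -> exists g : R, forall tau : {ffun L -> spin},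
  mu (agree_on (ball_V N) (glue tau xi)) = (w (glue tau xi) * g)%:E.
Proof.
move=> nN; have [c cE] := mu_marginals N.
pose rest sigma := energy J J1 J2 h (fun D => D `<=` ball_V N /\ ~ (D `&` [set` L] !=set0))
  ([set x | (size x < N)%N] `\` [set` L]) sigma.
have LN x : [set` L] x -> (size x < N)%N by move/L_setP => xn; exact: leq_trans xn nN.
exists (c * (expR (- beta * rest xi) * \big[*%R/1]_(x \in sphere N) boundary_law u v (xi x))).
move=> tau; rewrite cE (energy_ball_split _ LN) mulrDr expRD -/(w _).
rewrite -/(rest (glue tau xi)).
have -> : rest (glue tau xi) = rest xi.
  apply: energy_local => [D [_ D0] x Dx|x [_ xL]]; apply: glue_notin; apply/negP => //.
  by move=> xL; apply: D0; exists x.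
rewrite (_ : \big[*%R/1]_(x \in sphere N) boundary_law u v (glue tau xi x) =
  \big[*%R/1]_(x \in sphere N) boundary_law u v (xi x)); last first.
  apply: eq_fsbigr => x /set_mem xN; congr boundary_law; apply: glue_notin.
  by apply/negP => /LN; rewrite xN ltnn.
by congr EFin; ring.
Qed.

Let integral_scaled_indic (c : R) (S : set config) : 0 <= c -> measurable S ->
  (\int[mu]_omega (c * \1_S omega)%:E = c%:E * mu S)%E.
Proof.
move=> c0 mS; under eq_integral do rewrite EFinM.
rewrite ge0_integralZl_EFin //; first by rewrite integral_indic // setIT.
by apply/measurable_realfun.measurable_EFinP; exact: measurable_realfun.measurable_indic.
Qed.

Let agree_sub (A B : set site) sigma : A `<=` B -> agree_on B sigma `<=` agree_on A sigma.
Proof. by move=> AB omega H x /AB; exact: H. Qed.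

Let ball_le N M : (N <= M)%N -> ball_V N `<=` ball_V M.
Proof. by move=> NM x /leq_trans; exact. Qed.

(* Among the configurations agreeing with omega outside L, only the one that equals
   xi on L can lie in the cylinder of xi. *)
Let gibbs_kernel_cylinder N xi omega : (n <= N)%N ->
  gibbs_kernel beta J J1 J2 h [set` L] omega (agree_on (ball_V N) xi) =
  w xi / Z xi * \1_(agree_on (ball_V N `\` [set` L]) xi) omega.
Proof.
move=> nN; rewrite gibbs_kernelE indicE.
have [/set_mem H|/negP H] := boolP (omega \in _); last first.
  rewrite mulr0 big1 ?mul0r // => tau _; rewrite indicE memNset ?mulr0 // => E.
  apply: H; apply/mem_set => x [xN /negP xL].
  by rewrite -(E x xN) glue_notin.
have E : agree_on (ball_V N) xi (glue (pattern L xi) omega).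
  move=> x xN; have [xL|xL] := boolP (x \in L); first by rewrite glue_pattern.
  by rewrite glue_notin // (H x) //; split=> //; exact/negP.
have En := agree_sub (ball_le nN) E.
rewrite mulr1 (bigD1 (pattern L xi)) //= big1 ?addr0 => [|tau taux].
  rewrite indicE (mem_set E) mulr1 (w_local En) -(Z_local En); congr (_ / _).
  by apply: eq_bigr => tau _; rewrite glue_glue.
rewrite indicE memNset ?mulr0 // => F; case/eqP: taux.
rewrite -(pattern_glue tau omega); apply/ffunP => y; rewrite !ffunE.
by apply: F; apply: (ball_le nN); apply: ltnW; exact: L_ball (valP y).
Qed.

(** Freeing the spins on [L] gives the disjoint union of the cylinders over all patterns on [L],
    whose weights [w] add up to [Z]. *)
Let measure_agree_off N xi (g : R) : (n <= N)%N ->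
  (forall tau : {ffun L -> spin},
    mu (agree_on (ball_V N) (glue tau xi)) = (w (glue tau xi) * g)%:E) ->
  mu (agree_on (ball_V N `\` [set` L]) xi) = (Z xi * g)%:E.
Proof.
move=> nN gE.
have -> : agree_on (ball_V N `\` [set` L]) xi =
    \bigcup_(tau in [set: {ffun L -> spin}]) agree_on (ball_V N) (glue tau xi).
  apply/seteqP; split=> omega /=.
    move=> H; exists (pattern L omega) => // x xN.
    have [xL|xL] := boolP (x \in L); first by rewrite glue_pattern.
    by rewrite glue_notin // H //; split=> //; exact/negP.
  move=> [tau _ H] x [xN /negP xL]; rewrite H // glue_notin //.
rewrite measure_fin_bigcup; [|exact: finite_finset| |]; first last.
- by move=> tau _; apply: measurable_agree_on; exact: finite_ball.
- move=> tau tau' _ _ [omega [H H']].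
  rewrite -(pattern_glue tau xi) -(pattern_glue tau' xi); apply/ffunP => y; rewrite !ffunE.
  have yN : ball_V N (val y) by apply: (ball_le nN); apply: ltnW; exact: L_ball (valP y).
  by rewrite -(H _ yN) -(H' _ yN).
rewrite fsbig_setT_fin /Z mulr_suml -sumEFin.
by apply: eq_bigr => tau _; exact: gE.
Qed.

(** The kernel contributes [w xi / Z xi] and the cylinder with [L] freed has mass [Z xi * g]; their
    product is the mass [w xi * g] of the cylinder. *)
Let integral_kernel_cylinder N xi : (n <= N)%N ->
  (\int[mu]_omega (gibbs_kernel beta J J1 J2 h [set` L] omega (agree_on (ball_V N) xi))%:E
   = mu (agree_on (ball_V N) xi))%E.
Proof.
move=> nN; under eq_integral do rewrite gibbs_kernel_cylinder //.
have [g gE] := cylinder_weight xi nN.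
rewrite integral_scaled_indic ?divr_ge0 ?ltW //; last first.
  apply: measurable_agree_on; apply: sub_finite_set (finite_ball N) => x [].
  by [].
rewrite (measure_agree_off nN gE) -EFinM.
have := gE (pattern L xi); rewrite glue_pattern_off // => ->.
by congr EFin; have := Z_gt0 xi => ?; field; rewrite gt_eqF.
Qed.

Let D := fset_set (ball_V n).

Let DE : [set` D] = ball_V n.
Proof. by apply: fset_setK; exact: finite_ball. Qed.

(** A representative of the configurations with pattern [eta] on V_n. The spin outside V_n is an
    arbitrary choice, since [w] and [Z] depend only on V_n. *)
Let ref (eta : {ffun D -> spin}) : config := glue eta (fun=> spin1).

Let coef (p : {ffun D -> spin} * {ffun L -> spin}) : R :=
  w (glue p.2 (ref p.1)) / Z (ref p.1).

(** Once the pattern of [omega] on V_n is fixed, the weights are constants, and [omega] enters only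
    through whether each glued configuration lies in [A]. *)
Let gibbs_kernel_mixture omega A : gibbs_kernel beta J J1 J2 h [set` L] omega A =
  \sum_p coef p * \1_(agree_on (ball_V n) (ref p.1) `&` (glue p.2 : config -> config) @^-1` A) omega.
Proof.
rewrite gibbs_kernelE -(pair_bigA _ (fun eta tau => coef (eta, tau) *
  \1_(agree_on (ball_V n) (ref eta) `&` (glue tau : config -> config) @^-1` A) omega)) /=.
have refE : agree_on (ball_V n) (ref (pattern D omega)) omega.
  by rewrite -DE; apply/agree_on_pattern; rewrite pattern_glue.
rewrite (bigD1 (pattern D omega)) //= [X in _ + X]big1 ?addr0 => [|eta etaN]; last first.
  apply: big1 => tau _; rewrite indicE memNset ?mulr0 // => -[].
  by rewrite -DE => /agree_on_pattern; rewrite pattern_glue => E; rewrite E eqxx in etaN.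
rewrite mulr_suml; apply: eq_bigr => tau _.
rewrite /coef /= -(Z_local refE) -(w_local (glue_agree tau refE)) !indicE in_setI (mem_set refE).
by rewrite mulrAC; congr (_ * _%:R); rewrite /= !inE.
Qed.

Lemma gibbs_measure_finite A : measurable A ->
  (mu A = \int[mu]_omega (gibbs_kernel beta J J1 J2 h [set` L] omega A)%:E)%E.
Proof.
have coef_ge0 p : 0 <= coef p by rewrite divr_ge0 ?ltW.
have mball sigma N : measurable (agree_on (ball_V N) sigma).
  by apply: measurable_agree_on; exact: finite_ball.
(* The measure [m] is the right-hand side of the DLR equation as a function of the event. *)
have [m mE] := @finite_mixture R _ config mu _ (index_enum _) coef
  (fun p => agree_on (ball_V n) (ref p.1)) (fun p => glue p.2) coef_ge0
  (fun p => mball _ _) (fun p => measurable_glue p.2).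
have int_m B : measurable B ->
    (\int[mu]_omega (gibbs_kernel beta J J1 J2 h [set` L] omega B)%:E = m B)%E.
  move=> mB; rewrite mE //.
  have mS p : measurable (agree_on (ball_V n) (ref p.1) `&` (glue p.2 : config -> config) @^-1` B).
    by apply: measurableI => //; rewrite -[_ @^-1` _]setTI; exact: measurable_glue.
  under eq_integral do rewrite gibbs_kernel_mixture -sumEFin.
  rewrite ge0_integral_sum //; first last.
  - by move=> p omega _; rewrite lee_fin mulr_ge0.
  - move=> p; apply/measurable_realfun.measurable_EFinP; apply: measurable_realfun.measurable_funM => //.
    by apply: measurable_realfun.measurable_indic; exact: mS.
  by apply: eq_bigr => p _; apply: integral_scaled_indic; [exact: coef_ge0|exact: mS].
move=> mA; rewrite int_m //.
(* The sequence of sets of finite measure covering the space that [measure_unique] asks for: the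
   finitely many cylinders over V_n, then empty sets. *)
pose g k := nth set0 [seq agree_on (ball_V n) (ref eta) | eta : {ffun D -> spin}] k.
apply: (@measure_unique _ _ config _ g (cylinders_generate n) (@cylinders_setI n)) => //.
- move=> k; rewrite /g.
  have [kl|kl] := ltnP k (size [seq agree_on (ball_V n) (ref eta) | eta : {ffun D -> spin}]).
    have /mapP[eta _ ->] := mem_nth set0 kl.
    by right; exists n, (ref eta).
  by rewrite nth_default //; left.
- apply/seteqP; split=> // omega _.
  exists (index (pattern D omega) (enum {ffun D -> spin})) => //.
  rewrite /g (nth_map (pattern D omega)) ?index_mem ?mem_enum // nth_index ?mem_enum //.
  by rewrite -DE; apply/agree_on_pattern; rewrite pattern_glue.
- move=> B [->|[N [sigma [nN ->]]]]; first by rewrite !measure0.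
  by rewrite -int_m // integral_kernel_cylinder.
- move=> k; apply: le_lt_trans (probability_le1 _ _) _; last exact: ltry.
  rewrite /g.
  have [kl|kl] := ltnP k (size [seq agree_on (ball_V n) (ref eta) | eta : {ffun D -> spin}]).
    by have /mapP[eta _ ->] := mem_nth set0 kl.
  by rewrite nth_default.
Qed.

End Specification.

(** * Existence and distinctness of the Gibbs measures, and the theorem *)

Lemma marginals_gibbs (R : realType) (beta J J1 J2 h u v : R) (mu : probability config R) :
  has_marginals beta J J1 J2 h u v mu -> gibbs_measure beta J J1 J2 h mu.
Proof.
move=> mum L A finL mA; rewrite -(fset_setK finL).
(* One more than the largest depth in [L], so that the successors of [L] stay in the ball. *)
apply: (@gibbs_measure_finite _ _ _ _ _ _ _ (\max_(x <- fset_set L) size x).+1 _ u v) => //.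
by move=> x xL; rewrite ltnS; exact: (@leq_bigmax_seq _ _ xpredT (fun x : site => size x) x).
Qed.

Lemma ti_gibbs_measure_exists (R : realType) (beta J J1 J2 h u v : R) :
  0 < u -> 0 < v ->
  ti_system (expR (beta * J1)) (expR (beta * J) * Num.sqrt (expR (beta * J2)))
    (expR (beta * h)) u v ->
  exists mu : probability config R, ti_gibbs_measure beta J J1 J2 h u v mu.
Proof.
move=> u0 v0 uv; have [mu mum] := ti_marginals u0 v0 uv.
by exists mu; split=> //; exact: marginals_gibbs mum.
Qed.

(** For n = 0 the energy is an empty sum, so the root has spin weights proportional to 1, u, v, and
    total mass 1 fixes the constant. *)
Lemma root_spin_law (R : realType) (beta J J1 J2 h u v : R) (mu : probability config R) :
  0 < u -> 0 < v -> has_marginals beta J J1 J2 h u v mu ->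
  mu [set sigma : config | sigma [::] = spin1] = ((1 + u + v)^-1)%:E.
Proof.
move=> u0 v0 /(_ 0%N)[c cE].
have rootE s : mu [set sigma : config | sigma [::] = s] = (c * boundary_law u v s)%:E.
  have -> : [set sigma : config | sigma [::] = s] = agree_on (ball_V 0) (fun=> s).
    apply/seteqP; split=> sigma /= H; last exact: H.
    by move=> x; rewrite /ball_V /= leqn0 size_eq0 => /eqP ->.
  rewrite cE energy_ballE (_ : [set x | _] = set0); last by apply/seteqP; split.
  rewrite fsbig_set0 oppr0 mulr0 expR0 mul1r.
  rewrite (_ : sphere 0 = [set [::]]) ?fsbig_set1 //.
  by apply/seteqP; split=> [x /size0nil|_ ->].
have : (\sum_(s : spin) mu [set sigma : config | sigma [::] = s] = 1)%E.
  rewrite -(probability_setT mu) -(@fsbig_setT_fin _ _ _ spin) -measure_fin_bigcup //=.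
  - by congr (mu _); apply/seteqP; split=> // sigma _; exists (sigma [::]).
  - by move=> s t _ _ [sigma [/= -> ->]].
  - by move=> s _; exact: measurable_site.
under eq_bigr do rewrite rootE.
rewrite sumEFin !big_ord_recl big_ord0 /boundary_law /= => -[] c1.
have uv0 : 1 + u + v != 0 by rewrite gt_eqF // !addr_gt0.
rewrite rootE /boundary_law /= mulr1; congr EFin.
by apply: (mulIf uv0); rewrite mulVf // -[RHS]c1; ring.
Qed.

Lemma ti_gibbs_measures_distinct (R : realType) (beta J J1 J2 h u v u' v' : R)
    (mu nu : probability config R) :
  ti_gibbs_measure beta J J1 J2 h u v mu -> ti_gibbs_measure beta J J1 J2 h u' v' nu ->
  u + v != u' + v' -> distinct_measures mu nu.
Proof.
move=> [u0 v0 _ _ mum] [u0' v0' _ _ num] uv.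
exists [set sigma : config | sigma [::] = spin1]; split; first exact: measurable_site.
rewrite (root_spin_law u0 v0 mum) (root_spin_law u0' v0' num) => -[] /invr_inj.
by rewrite -!addrA => /addrI /eqP; rewrite (negbTE uv).
Qed.

Lemma ti_system_diagonal (R : realType) (theta1 ttheta theta3 u : R) :
  theta3 * u = potts_f theta1 ttheta u -> ti_system theta1 ttheta theta3 u u.
Proof.
by move=> E; split; rewrite E /potts_f; congr (_ / _); ring.
Qed.


Theorem corollary1 (R : realType) (beta J J1 J2 h : R)
    (beta_gt0 : 0 < beta)
    (J_neq0 : J != 0) (J1_neq0 : J1 != 0) (J2_neq0 : J2 != 0) (h_neq0 : h != 0) :
  let theta := expR (beta * J) in
  let theta1 := expR (beta * J1) in
  let theta2 := expR (beta * J2) in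
  let theta3 := expR (beta * h) in
  let ttheta := theta * Num.sqrt theta2 in
  let f := potts_f theta1 ttheta in
  let A := potts_A theta1 ttheta in
  let B := potts_B theta1 ttheta in
  let C := potts_C theta1 ttheta in
  forall eta1 eta2 : R,
  is_eta f eta1 eta2 ->
  1 / theta ^+ 2 < theta2 ->
  0 < 3 * B ^+ 2 - 8 * A * C ->
  regionH (theta1, ttheta) ->
  eta1 < theta3 < eta2 ->
  (exists u1 u2 u3 : R,
     [/\ u1 < u2, u2 < u3,
         [set u : R | 0 < u /\ theta3 * u = f u] = [set u1; u2; u3]
       & exists mu1 mu2 mu3 : probability config R,
           [/\ ti_gibbs_measure beta J J1 J2 h u1 u1 mu1,
               ti_gibbs_measure beta J J1 J2 h u2 u2 mu2
             & ti_gibbs_measure beta J J1 J2 h u3 u3 mu3]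
           /\ [/\ distinct_measures mu1 mu2, distinct_measures mu1 mu3
                & distinct_measures mu2 mu3]])
  /\ phase_transition beta J J1 J2 h.
Proof.
move=> theta theta1 theta2 theta3 ttheta f A B C eta1 eta2 eta _ _ _ theta3P.
have t1 : 0 < theta1 by exact: expR_gt0.
have tt : 0 < ttheta by rewrite mulr_gt0 ?sqrtr_gt0 ?expR_gt0.
have tt1 : 0 < ttheta ^+ 2 * theta1 by rewrite mulr_gt0 ?exprn_gt0.
have [u1 [u2 [u3 [u12 u23 E]]]] : exists u1 u2 u3 : R, [/\ u1 < u2, u2 < u3 &
    [set u | 0 < u /\ theta3 * u = f u] = [set u1; u2; u3]].
  (* The six coefficients of [potts_f] are positive because [theta1] and [ttheta] are. *)
  by apply: (quadratic_ratio_three_fixpoints _ _ _ _ _ _ eta theta3P); lra.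
have fixP u : [set u1; u2; u3] u -> 0 < u /\ ti_system theta1 ttheta theta3 u u.
  by rewrite -E => -[u0 /ti_system_diagonal].
have [u10 s1] : 0 < u1 /\ ti_system theta1 ttheta theta3 u1 u1 by apply: fixP; left; left.
have [u20 s2] : 0 < u2 /\ ti_system theta1 ttheta theta3 u2 u2 by apply: fixP; left; right.
have [u30 s3] : 0 < u3 /\ ti_system theta1 ttheta theta3 u3 u3 by apply: fixP; right.
have [mu1 m1] := ti_gibbs_measure_exists u10 u10 s1.
have [mu2 m2] := ti_gibbs_measure_exists u20 u20 s2.
have [mu3 m3] := ti_gibbs_measure_exists u30 u30 s3.
have dist u v mu nu : u < v -> ti_gibbs_measure beta J J1 J2 h u u mu ->
    ti_gibbs_measure beta J J1 J2 h v v nu -> distinct_measures mu nu.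
  move=> uv mum num; apply: (ti_gibbs_measures_distinct mum num).
  by rewrite lt_eqF // ltrD.
split; last by exists mu1, mu2; split; [case: m1|case: m2|exact: dist u12 m1 m2].
exists u1, u2, u3; split=> //; exists mu1, mu2, mu3; split=> //.
by split; [exact: dist u12 m1 m2|exact: dist (lt_trans u12 u23) m1 m3|exact: dist u23 m2 m3].
Qed.
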